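(* Let $v \equiv 1,3 \pmod 6$ be a positive integer. Then \[ f(v) = \frac{2v+5-\sqrt{24v+25}}{2} \] if and only if \[ v \in \{216z^2+42z+1,\ 216z^2+186z+39,\ 216z^2+138z+21,\ 216z^2+282z+91\} \] for some non-negative integer $z$.
   Context: A Steiner triple system of order $v$ (STS$(v)$) is a pair $(X,\mathcal{B})$ where $X$ is a set of $v$ points and $\mathcal{B}$ is a set of $3$-element subsets of $X$ (blocks) such that every pair of distinct points of $X$ is contained in exactly one block. For $Y \subseteq X$ and $\mathcal{C} \subseteq \mathcal{B}$, the pair $(Y,\mathcal{C})$ is a nonincident set of points and blocks if $y \notin B$ for all $y \in Y$ and all $B \in \mathcal{C}$. $f(v)$ denotes the maximum integer $s$ such that there exists a nonincident set of $s$ points and $s$ blocks in some STS$(v)$. *)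

(* Defs.v *)
From mathcomp Require Import all_boot all_order all_algebra.

Set Implicit Arguments.
Unset Strict Implicit.
Unset Printing Implicit Defensive.

Section SteinerTripleSystems.

Variable X : finType.
Implicit Types (Bs C : {set {set X}}) (Y : {set X}).

Definition is_STS Bs : bool :=
  [forall B in Bs, #|B| == 3] &&
  [forall x : X, forall y : X, (x != y) ==>
     (#|[set B in Bs | (x \in B) && (y \in B)]| == 1)].

Definition nonincident Y C : bool :=
  [forall y in Y, forall B in C, y \notin B].

Definition has_nonincident_pair (s : nat) : bool :=
  [exists Bs : {set {set X}}, is_STS Bs &&
    [exists Y : {set X}, exists C : {set {set X}},
      [&& C \subset Bs, nonincident Y C, #|Y| == s & #|C| == s]]].

End SteinerTripleSystems.

(* The point set is taken to be 'I_v: the notion is invariant under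
   relabelling the points. The range s <= v loses nothing, s being the size
   of a set of points. If an STS(v) exists then s = 0 is admissible, so this
   is a genuine maximum; otherwise the value is 0 by convention. *)
Definition f (v : nat) : nat :=
  \max_(s < v.+1 | has_nonincident_pair 'I_v s) s.

(* Main.v *)
Require Import Defs.
From mathcomp Require Import all_boot all_order all_algebra.
From mathcomp Require Import zify ring lra.
Import Order.TTheory GRing.Theory Num.Theory.

(** Let Y, C be nonincident of size s in an STS(v), and let w = v - s. Counting
    ordered pairs of points outside Y gives 6s <= w(w - 1), that is
    6v <= w(w + 5), with equality iff C is a triple system on the complement
    of Y. The formula for f(v) says exactly that w(w + 5) = 6v for
    w = v - f(v), so it holds iff some STS(v) has a sub-STS(w) with
    w(w + 5) = 6v. Then w is odd, and with v = 1, 3 mod 6 this forces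
    w = 1, 13, 9 or 21 mod 36, which yields the four families. Conversely, in
    all four families v factors so that the subsystem lives in a direct
    product of smaller systems, which are supplied by the constructions of
    Bose (orders 6n + 3) and Skolem (orders 6n + 1). *)

(** * Double counting of the point pairs covered by blocks *)

Section Counting.
Variable X : finType.
Implicit Types (C Bs : {set {set X}}) (W Y : {set X}).

Definition covering C (x y : X) : {set {set X}} :=
  [set B in C | (x \in B) && (y \in B)].

(** Each block through [x] has exactly two further points, both in [W]. *)
Lemma sum_covering1 C W x :
  (forall B, B \in C -> #|B| = 3 /\ B \subset W) ->
  \sum_(y in W :\ x) #|covering C x y| = 2 * #|[set B in C | x \in B]|.
Proof.
move=> CP.
under eq_bigr do rewrite -sum1_card.
rewrite (exchange_big_dep (fun B => B \in [set B in C | x \in B])) /=; last first.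
  by move=> y B _; rewrite !inE => /and3P[-> ->].
rewrite [RHS]mulnC -sum_nat_const; apply: eq_bigr => B; rewrite inE => /andP[BC xB].
have [B3 /subsetP BW] := CP _ BC.
have -> : 2 = #|B :\ x| by have := cardsD1 x B; rewrite xB B3 => -[].
rewrite sum1_card.
apply: eq_card => y; rewrite !inE [LHS]unfold_in /= !inE BC xB /=.
case: (boolP (y \in B)) => yB; rewrite ?andbF ?andbT //.
by rewrite BW ?andbT.
Qed.

Lemma sum_covering C W :
  (forall B, B \in C -> #|B| = 3 /\ B \subset W) ->
  \sum_(x in W) \sum_(y in W :\ x) #|covering C x y| = 6 * #|C|.
Proof.
move=> CP.
under eq_bigr do rewrite (sum_covering1 _ W) // -sum1_card big_distrr /=.
rewrite (exchange_big_dep (fun B => B \in C)) /=; last first.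
  by move=> y B _; rewrite !inE => /andP[].
rewrite [RHS]mulnC -sum_nat_const; apply: eq_bigr => B BC.
have [B3 /subsetP BW] := CP _ BC.
rewrite sum_nat_const (_ : 6 = 3 * 2) // -B3; congr (_ * _).
apply: eq_card => y; rewrite [LHS]unfold_in /= inE BC /=.
by case: (boolP (y \in B)) => yB; rewrite ?andbF ?andbT ?BW.
Qed.

Lemma sum_offdiag W : \sum_(x in W) \sum_(y in W :\ x) 1 = #|W| * #|W|.-1.
Proof.
rewrite -sum_nat_const; apply: eq_bigr => x xW.
by rewrite sum1_card (cardsD1 x W) xW.
Qed.

Lemma STS_card3 Bs B : is_STS Bs -> B \in Bs -> #|B| = 3.
Proof. by move=> /andP[/forall_inP H _] /H/eqP. Qed.

Lemma STS_covering Bs x y : is_STS Bs -> x != y -> #|covering Bs x y| = 1.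
Proof. by move=> /andP[_ /forallP/(_ x)/forallP/(_ y)/implyP H] /H/eqP. Qed.

Lemma nonincidentP Y C :
  reflect (forall B, B \in C -> B \subset ~: Y) (nonincident Y C).
Proof.
apply: (iffP forall_inP) => [H B BC|H y yY].
  apply/subsetP=> y yB; rewrite inE; apply/negP=> yY.
  by have /forall_inP/(_ B BC) := H y yY; rewrite yB.
apply/forall_inP=> B /H/subsetP/(_ y); rewrite inE yY => Hy.
by apply/negP=> /Hy.
Qed.

Lemma covering_le1 Bs C x y :
  is_STS Bs -> C \subset Bs -> x != y -> #|covering C x y| <= 1.
Proof.
move=> STS /subsetP CB xy; rewrite -(STS_covering _ _ _ STS xy).
by apply/subset_leq_card/subsetP=> B; rewrite !inE => /andP[/CB -> ->].
Qed.

Lemma blocks_within_bound Bs C W :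
  is_STS Bs -> C \subset Bs -> (forall B, B \in C -> B \subset W) ->
  6 * #|C| <= #|W| * #|W|.-1.
Proof.
move=> STS CB CW; rewrite -(sum_covering C W) => [|B BC]; last first.
  by split; [exact: STS_card3 STS (subsetP CB _ BC) | exact: CW].
rewrite -sum_offdiag; apply: leq_sum => x _; apply: leq_sum => y.
by rewrite !inE eq_sym => /andP[xy _]; exact: covering_le1 STS CB xy.
Qed.

(* Equality forces C to be a triple system on W; the blocks of C through a
   point of W then split the other points of W into pairs. *)
Lemma blocks_within_tight_odd Bs C W :
  is_STS Bs -> C \subset Bs -> (forall B, B \in C -> B \subset W) ->
  6 * #|C| = #|W| * #|W|.-1 -> 0 < #|W| -> odd #|W|.
Proof.
move=> STS CB CW eqW /card_gt0P[x xW].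
have CP B : B \in C -> #|B| = 3 /\ B \subset W.
  by move=> BC; split; [exact: STS_card3 STS (subsetP CB _ BC) | exact: CW].
have le1 z y : y \in W :\ z -> #|covering C z y| <= 1.
  by rewrite !inE eq_sym => /andP[zy _]; exact: covering_le1 STS CB zy.
(* No term exceeds 1, so equality of the full double sums forces equality already in the row of
   [x]. *)
have /eqP : \sum_(y in W :\ x) #|covering C x y| = \sum_(y in W :\ x) 1.
  move: eqW; rewrite -(sum_covering C W) // -sum_offdiag.
  rewrite (bigD1 x) //= [RHS](bigD1 x) //=.
  have : \sum_(y in W :\ x) #|covering C x y| <= \sum_(y in W :\ x) 1.
    by apply: leq_sum => y; exact: le1.
  have : \sum_(z in W | z != x) \sum_(y in W :\ z) #|covering C z y| <=
         \sum_(z in W | z != x) \sum_(y in W :\ z) 1.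
    by apply: leq_sum => z _; apply: leq_sum => y; exact: le1.
  have aux (a b c d : nat) : c <= d -> a <= b -> a + c = b + d -> a = b by lia.
  exact: aux.
rewrite (sum_covering1 C W) // sum1_card (cardsD1 x W) xW => /eqP <-.
by rewrite /= mul2n odd_double.
Qed.

End Counting.

(** * Steiner quasigroups and their triple systems *)

(* Steiner quasigroups encode triple systems: the blocks are the sets
   {x, y, op x y} with x <> y, and subsystems are the closed subsets. *)
Definition steiner (T : Type) (op : T -> T -> T) : Prop :=
  [/\ forall x, op x x = x, forall x y, op x y = op y x
    & forall x y, op x (op x y) = y].

Definition closed_under (T : finType) (op : T -> T -> T) (W : {set T}) : Prop :=
  forall x y, x \in W -> y \in W -> op x y \in W.

Definition steiner_order (n : nat) : Prop :=
  exists (T : finType) (op : T -> T -> T), #|T| = n /\ steiner T op.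

Definition steiner_suborder (n w : nat) : Prop :=
  exists (T : finType) (op : T -> T -> T) (W : {set T}),
    [/\ #|T| = n, steiner T op, closed_under T op W & #|W| = w].

Section Blocks.
Variables (T : finType) (op : T -> T -> T).
Hypothesis opP : steiner T op.

Definition block (x y : T) : {set T} := [set x; y; op x y].

Definition blocks : {set {set T}} :=
  [set block p.1 p.2 | p in [set p : T * T | p.1 != p.2]].

Lemma opxx x : op x x = x. Proof. by case: opP. Qed.
Lemma opC x y : op x y = op y x. Proof. by case: opP. Qed.
Lemma opK x y : op x (op x y) = y. Proof. by case: opP. Qed.

Lemma op_eql x y : (op x y == x) = (x == y).
Proof.
apply/eqP/eqP => [E|<-]; last exact: opxx.
by rewrite -(opK x y) E opxx.
Qed.

Lemma op_eqr x y : (op x y == y) = (x == y).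
Proof. by rewrite opC op_eql eq_sym. Qed.

Lemma blocksP B :
  reflect (exists x y, x != y /\ B = block x y) (B \in blocks).
Proof.
apply: (iffP imsetP) => [[[x y]]|[x [y [xy ->]]]].
  by rewrite inE /= => xy ->; exists x, y.
by exists (x, y); rewrite ?inE.
Qed.

Lemma card_block x y : x != y -> #|block x y| = 3.
Proof.
move=> xy; rewrite /block -setUA cardsU1 !inE negb_or xy eq_sym op_eql xy /=.
by rewrite cards2 eq_sym op_eqr xy.
Qed.

Lemma block_sym x y : block x y = block y x.
Proof. by rewrite /block opC [[set x; y]]setUC. Qed.

Lemma block_op x y : block x (op x y) = block x y.
Proof. by rewrite /block opK setUAC. Qed.

(** Any two distinct points of a block generate its third point: the ordered choices reduce to one
    by [block_sym] and [block_op]. *)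
Lemma block_unique a b x y :
  x != y -> x \in block a b -> y \in block a b -> block a b = block x y.
Proof.
have bo : block (op a b) b = block a b.
  by rewrite block_sym opC block_op block_sym.
rewrite !inE -!orbA => xy /or3P[]/eqP ? /or3P[]/eqP ?; subst x y;
  rewrite ?eqxx // in xy.
- by rewrite block_op.
- by rewrite block_sym.
- by rewrite opC block_op block_sym.
- by rewrite [RHS]block_sym block_op.
Qed.

Lemma covering_blocks x y : x != y ->
  [set B in blocks | (x \in B) && (y \in B)] = [set block x y].
Proof.
move=> xy; apply/setP=> B; rewrite !inE.
apply/idP/eqP => [/andP[/blocksP[a [b [ab ->]]] /andP[xB yB]]|->].
  exact: block_unique.
by rewrite !inE !eqxx orbT !andbT; apply/blocksP; exists x, y.
Qed.

Lemma blocks_STS : is_STS blocks.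
Proof.
apply/andP; split.
  by apply/forall_inP=> B /blocksP[x [y [xy ->]]]; rewrite card_block.
apply/forallP=> x; apply/forallP=> y; apply/implyP=> xy.
by rewrite covering_blocks ?cards1.
Qed.

End Blocks.

(** * Direct products and small subsystems *)

Lemma steiner_suborder_prod (m n k : nat) :
  steiner_order m -> steiner_suborder n k -> steiner_suborder (m * n) (m * k).
Proof.
move=> [S [f [<- [fxx fC fK]]]] [T [g [W [<- [gxx gC gK] Wc <-]]]].
exists (S * T)%type, (fun p q => (f p.1 q.1, g p.2 q.2)), (setX [set: S] W).
split; first by rewrite card_prod.
- by split=> [[x y]|[x y] [x' y']|[x y] [x' y']] /=; congr pair.
- by move=> [x y] [x' y']; rewrite !inE /=; exact: Wc.
- by rewrite cardsX cardsT.
Qed.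

Lemma steiner_suborder1 (n : nat) : 0 < n -> steiner_order n -> steiner_suborder n 1.
Proof.
move=> n0 [T [g [Tn gP]]]; have /card_gt0P[x _] : 0 < #|T| by rewrite Tn.
exists T, g, [set x]; split=> //; last by rewrite cards1.
by move=> y z; rewrite !inE => /eqP-> /eqP->; rewrite opxx.
Qed.

(** A single block is a subsystem, since any two of its points determine it. *)
Lemma steiner_suborder3 (n : nat) : 1 < n -> steiner_order n -> steiner_suborder n 3.
Proof.
move=> n1 [T [g [Tn gP]]].
have /card_gt1P[x [y [_ _ xy]]] : 1 < #|T| by rewrite Tn.
exists T, g, (block T g x y); split=> //; last exact: card_block.
move=> a b aB bB; case: (eqVneq a b) => [->|ab]; first by rewrite opxx.
by rewrite (block_unique T g gP _ _ _ _ ab aB bB) !inE eqxx !orbT.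
Qed.

(** [f] is defined on the points ['I_v], so the structure is transported along the enumeration of
    [T]. *)
Lemma steiner_suborder_ord (n w : nat) : steiner_suborder n w ->
  exists (op : 'I_n -> 'I_n -> 'I_n) (W : {set 'I_n}),
    [/\ steiner 'I_n op, closed_under 'I_n op W & #|W| = w].
Proof.
move=> [T [g [W [<- [gxx gC gK] Wc <-]]]].
exists (fun i j => enum_rank (g (enum_val i) (enum_val j))), (enum_rank @: W).
split; last by rewrite card_imset //; exact: enum_rank_inj.
- by split=> [i|i j|i j]; rewrite ?enum_rankK ?gxx ?gK ?enum_valK // gC.
- move=> i j /imsetP[x xW ->] /imsetP[y yW ->].
  by rewrite !enum_rankK imset_f // Wc.
Qed.

(** * The constructions of Bose and Skolem *)

Section Bose.
Local Open Scope ring_scope.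
Variables (G : finZmodType) (h hV : G -> G).
Hypotheses (hK : cancel h hV) (hVK : cancel hV h).
Implicit Types (x y : G) (i j : 'I_3).

Notation "x ∘ y" := (h (x + y)) (at level 45).
Notation "x ⧵ y" := (hV y - x) (at level 45).

(* x ∘ y is a commutative quasigroup on G with left division x ⧵ y. The blocks
   on G * Z/3 are {(x,i), (y,i), (x ∘ y,i+1)} for x <> y, and {x} * Z/3 when
   x ∘ x = x. The pairs (x,i), (x ∘ x,i+1) with x ∘ x <> x are left uncovered:
   on them the operation is None. *)
Definition across x i y : option (G * 'I_3) :=
  if x ∘ x == y then (if x == y then Some (x, i + 2) else None)
  else Some (x ⧵ y, i).

Definition bose_op (a b : G * 'I_3) : option (G * 'I_3) :=
  if a.2 == b.2 then Some (if a.1 == b.1 then a else (a.1 ∘ b.1, a.2 + 1))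
  else if b.2 == a.2 + 1 then across a.1 a.2 b.1 else across b.1 b.2 a.1.

Let addKdiv x y : x ⧵ (x ∘ y) = y.
Proof. by rewrite hK addrC addKr. Qed.

Let divKadd x y : x ∘ (x ⧵ y) = y.
Proof. by rewrite addrC subrK hVK. Qed.

Let ord3 (i j : 'I_3) : [|| j == i, j == i + 1 | j == i + 2].
Proof. by case: i j => [[|[|[]]]//] ? [[|[|[]]]//]. Qed.

Let ord3E i : ((i == i + 1 = false)%R * (i == i + 2 = false)%R *
  (i + 1 == i = false)%R * (i + 2 == i = false)%R *
  (i + 1 == i + 2 = false)%R * (i + 2 == i + 1 = false)%R *
  (i + 1 + 1 = i + 2)%R * (i + 2 + 1 = i)%R *
  (i + 1 + 2 = i)%R * (i + 2 + 2 = i + 1)%R)%type.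
Proof. by do !split; case: i => [[|[|[]]]//] ?; apply/val_inj. Qed.

Lemma bose_opxx a : bose_op a a = Some a.
Proof. by rewrite /bose_op !eqxx. Qed.

Lemma bose_opC a b : bose_op a b = bose_op b a.
Proof.
case: a b => [x i] [y j]; rewrite /bose_op /=.
case/or3P: (ord3 i j) => /eqP->; rewrite ?eqxx ?ord3E ?eqxx //=.
by rewrite eq_sym addrC; case: eqP => [->|].
Qed.

Lemma bose_opK a b c : bose_op a b = Some c -> bose_op a c = Some b.
Proof.
case: a b => [x i] [y j]; rewrite /bose_op /=.
case/or3P: (ord3 i j) => /eqP->; rewrite ?eqxx ?ord3E ?eqxx /=.
- case: (eqVneq x y) => [<-|xy] [<-] /=; first by rewrite !eqxx.
  rewrite ord3E eqxx /across (can_eq hK) (inj_eq (addrI x)) (negbTE xy).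
  by rewrite addKdiv.
- rewrite /across; case: (eqVneq (x ∘ x) y) => [xxy|xxy].
    case: (eqVneq x y) => // xy [<-] /=; rewrite -{y}xy in xxy *.
    by rewrite !ord3E xxy !eqxx.
  move=> [<-] /=; rewrite eqxx.
  case: eqP => [E|_]; first by rewrite -{1}(divKadd x y) -E eqxx in xxy.
  by rewrite divKadd.
- rewrite /across; case: (eqVneq (y ∘ y) x) => [yyx|yyx].
    case: (eqVneq y x) => // yx [<-] /=; rewrite {y}yx in yyx *.
    by rewrite ?ord3E ?eqxx ?yyx ?eqxx.
  move=> [<-] /=; rewrite !ord3E /across.
  have divKadd' : h (hV x - y + y) = x by rewrite addrC divKadd.
  case: eqP => [E|_]; last by rewrite subKr.
  (* Put [z = y ⧵ x]. Then [z ∘ z = x = z ∘ y], and cancelling gives [z = y], against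
     [y ∘ y <> x]. *)
  have yE : hV x - y = y.
    by apply: (@addrI _ (hV x - y)); apply: (can_inj hK); rewrite E.
  by rewrite yE in E; rewrite E eqxx in yyx.
Qed.

(** When every element is idempotent no pair is left uncovered, so the default of [odflt] is never
    reached. *)
Lemma bose_steiner : (forall x, x ∘ x = x) ->
  steiner _ (fun a b => odflt a (bose_op a b)).
Proof.
move=> hD; have total a b : {c | bose_op a b = Some c}.
  case E : (bose_op a b) => [c|]; first by exists c.
  case: a b E => [x i] [y j]; rewrite /bose_op /across /= !hD.
  by do 4?case: ifP => //.
split=> [a|a b|a b]; first by rewrite bose_opxx.
  by rewrite bose_opC; have [c ->] := total b a.
by have [c E] := total a b; rewrite E /= (bose_opK _ _ _ E).
Qed.

(* Skolem's half-idempotent quasigroup: P holds on the idempotents, and s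
   exchanges them with the other elements. The uncovered pairs then form a
   perfect matching, whose edges are completed to blocks by a point None at
   infinity. *)
Variables (P : pred G) (s : G -> G).
Hypotheses (hD : forall x, x ∘ x = if P x then x else s x).
Hypotheses (sK : involutive s) (Ps : forall x, P (s x) = ~~ P x).

(** The other end of the uncovered pair at [a]: a non-idempotent [x] has its square [s x] one level
    up, while an idempotent [x] is the square of [s x] one level down, [+ 2] being [- 1] modulo
    3. *)
Definition partner (a : G * 'I_3) : G * 'I_3 :=
  (s a.1, if P a.1 then a.2 + 2 else a.2 + 1).

Lemma bose_op_None a b : (bose_op a b == None) = (b == partner a).
Proof.
have sneq x : x == s x = false.
  by apply/eqP=> E; have := Ps x; rewrite -E; case: (P x).
case: a b => [x i] [y j]; rewrite /bose_op /partner /across /= xpair_eqE.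
case/or3P: (ord3 i j) => /eqP->; rewrite ?eqxx ?ord3E ?eqxx /= ?hD.
- by do 2!case: ifP; rewrite ?ord3E ?andbF.
- case: (boolP (P x)) => Px; rewrite ?ord3E ?eqxx ?andbF ?andbT.
    by case: (x == y).
  by rewrite [y == _]eq_sym; case: (eqVneq (s x) y) => // <-; rewrite sneq.
- case: (boolP (P y)) => Py.
    rewrite [LHS](_ : _ = false); last by case: (y == x).
    apply/esym/andP=> -[/eqP E]; move: Py; rewrite E Ps => /negbTE->.
    by rewrite ord3E.
  rewrite (can2_eq sK sK); case: (eqVneq y (s x)) => // E.
  move: Py; rewrite E Ps negbK => ->.
  by rewrite eqxx [s x == x]eq_sym sneq.
Qed.

(** Being an uncovered pair is symmetric, because [bose_op] is commutative. *)
Lemma partnerK : involutive partner.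
Proof. by move=> a; apply/esym/eqP; rewrite -bose_op_None bose_opC bose_op_None. Qed.

Definition skolem_op (a b : option (G * 'I_3)) : option (G * 'I_3) :=
  match a, b with
  | None, None => None
  | None, Some c | Some c, None => Some (partner c)
  | Some c, Some d => bose_op c d
  end.

Lemma skolem_steiner : steiner _ skolem_op.
Proof.
split=> [[a|]|[a|] [b|]|[a|] [b|]] //=.
- exact: bose_opxx.
- exact: bose_opC.
- case E : (bose_op a b) => [c|] /=; first exact: bose_opK E.
  by move/eqP: E; rewrite bose_op_None => /eqP->.
- by apply/eqP; rewrite bose_op_None.
- by rewrite partnerK.
Qed.

End Bose.

Lemma steiner_order_3mod6 n : steiner_order (6 * n + 3).
Proof.
pose G : finZmodType := 'I_(2 * n).+1.
(* [n + 1] inverts 2 modulo [2n + 1], so [x ∘ y] is the mean of [x] and [y], which is idempotent. *)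
have dblK (x : G) : (x *+ n.+1 *+ 2 = x)%R.
  rewrite -mulrnA (_ : n.+1 * 2 = (2 * n).+1 + 1) ?mulrnDr; last by lia.
  rewrite [X in (X + _)%R](_ : _ = 0%R) ?add0r //.
  by rewrite Zp_mulrn; apply/val_inj; rewrite /= modnMl.
eexists (prod G 'I_3), _; split; first by rewrite card_prod !card_ord; lia.
apply: (@bose_steiner G (fun x => (x *+ n.+1)%R) (fun x => (x *+ 2)%R)) => x.
- exact: dblK.
- by rewrite -mulrnA mulnC mulrnA.
- by rewrite -mulr2n -mulrnA mulnC mulrnA.
Qed.

Lemma steiner_order_1mod6 n : steiner_order (6 * n + 1).
Proof.
case: n => [|n].
  by exists unit, (fun _ _ => tt); split; [rewrite card_unit|split=> [[]||x []]].
pose G : finZmodType := 'I_(2 * n + 1).+1.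
(* The group has even order [2n + 2]; [h] sends [2k] to [k] and [2k + 1] to [k + n + 1]. Hence
   [x ∘ x] is [x] for [x <= n] and [x - (n + 1)] otherwise, and [s] shifts by half the order. *)
pose h (t : G) : G := inord (t./2 + odd t * n.+1).
pose hV (u : G) : G := inord (if u <= n then 2 * u else 2 * (u - n.+1) + 1).
pose s (x : G) : G := inord (if x <= n then x + n.+1 else x - n.+1).
exists (option (G * 'I_3)%type), (@skolem_op G h hV (fun x => x <= n) s).
split; first by rewrite card_option card_prod !card_ord; lia.
have ltG (x : G) := ltn_ord x.
have hE x : h x = x./2 + odd x * n.+1 :> nat.
  by rewrite inordK //; have := ltG x; lia.
have hVE x : hV x = (if x <= n then 2 * x else 2 * (x - n.+1) + 1) :> nat.
  by rewrite inordK //; have := ltG x; case: (leqP x n); lia.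
have sE x : s x = (if x <= n then x + n.+1 else x - n.+1) :> nat.
  by rewrite inordK //; have := ltG x; case: (leqP x n); lia.
apply: skolem_steiner => x.
- apply/val_inj; rewrite /= hVE hE; have := ltG x.
  by have := odd_double_half x; case: (odd x); case: ifP; lia.
- apply/val_inj; rewrite /= hE; have := ltG x; have := hVE x.
  by have := odd_double_half (hV x); case: (odd _); case: (leqP x n); lia.
- have xxE : (x + x)%R = (if x <= n then x + x else x + x - (2 * n + 2)) :> nat.
    rewrite /= -[RHS](@modn_small _ (2 * n + 1).+1); have := ltG x.
      case: (leqP x n) => xn _ //.
      have -> : x + x = x + x - (2 * n + 2) + (2 * n + 1).+1 by lia.
      by rewrite modnDr; congr (_ %% _); lia.
    by case: (leqP x n); lia.
  apply/val_inj; rewrite fun_if /= hE sE; have := ltG x; move: xxE.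
  have := odd_double_half (x + x)%R.
  by case: (odd _); case: (leqP x n); lia.
- apply/val_inj; rewrite /= sE; have := sE x; have := ltG x.
  by case: (leqP x n) => ? ? ->; case: ifP; lia.
- by rewrite sE; have := ltG x; case: (leqP x n); lia.
Qed.

(** * Subsystems and the value of [f] *)

Lemma suborder_nonincident (n w : nat) :
  steiner_suborder n w -> 6 * (n - w) = w * w.-1 ->
  has_nonincident_pair 'I_n (n - w).
Proof.
move=> /steiner_suborder_ord[op [W [opP Wc Ww]]] nw.
apply/existsP; exists (blocks _ op); rewrite blocks_STS //=.
apply/existsP; exists (~: W); apply/existsP.
pose C := [set B in blocks _ op | B \subset W].
have CP B : B \in C -> #|B| = 3 /\ B \subset W.
  rewrite inE => /andP[/blocksP[x [y [xy ->]]] ->].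
  by rewrite (card_block _ _ opP).
exists C; apply/and4P; split.
- by apply/subsetP=> B; rewrite inE => /andP[].
- by apply/nonincidentP=> B /CP[_]; rewrite setCK.
- by rewrite cardsCs setCK card_ord Ww.
- have /eqP := sum_covering _ C W CP.
  (* By closure, the block through two points of [W] stays in [W], so every pair in [W] is covered
     exactly once. *)
  rewrite (eq_bigr (fun x => \sum_(y in W :\ x) 1)) => [|x xW].
    by rewrite sum_offdiag Ww -nw eqn_pmul2l // eq_sym.
  apply: eq_bigr => y; rewrite !inE eq_sym => /andP[xy yW].
  rewrite -(cards1 (block _ op x y)) -(covering_blocks _ _ opP) //.
  apply: eq_card => B; rewrite !inE; apply: andb_id2r => BP.
  case: (boolP (B \in _)) => // BB.
  have : B \in [set block _ op x y].
    by rewrite -(covering_blocks _ _ opP) // inE BB BP.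
  rewrite inE => /eqP->; rewrite !subUset !sub1set xW yW.
  exact: Wc.
Qed.

Lemma nonincident_bound (v s : nat) :
  has_nonincident_pair 'I_v s -> 6 * s <= (v - s) * (v - s).-1.
Proof.
move=> /existsP[Bs /andP[STS /existsP[Y /existsP[C]]]].
move=> /and4P[CB /nonincidentP YC /eqP Ys /eqP Cs].
have <- : #|~: Y| = v - s by rewrite cardsCs setCK card_ord Ys.
by rewrite -Cs; exact: blocks_within_bound STS CB YC.
Qed.

Lemma nonincident_tight_odd (v s : nat) : s < v ->
  has_nonincident_pair 'I_v s -> 6 * s = (v - s) * (v - s).-1 -> odd (v - s).
Proof.
move=> sv /existsP[Bs /andP[STS /existsP[Y /existsP[C]]]].
move=> /and4P[CB /nonincidentP YC /eqP Ys /eqP Cs] eq_s.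
have Wc : #|~: Y| = v - s by rewrite cardsCs setCK card_ord Ys.
rewrite -Wc; apply: (blocks_within_tight_odd _ Bs C) => //.
  by rewrite Wc Cs.
by rewrite Wc subn_gt0.
Qed.

(** An empty maximum defaults to 0, so a positive value is attained. *)
Lemma f_pair (v : nat) : 0 < f v -> has_nonincident_pair 'I_v (f v).
Proof.
rewrite /f; case: (pickP (fun s : 'I_v.+1 => has_nonincident_pair 'I_v s)).
  move=> s0 s0P _; rewrite (bigop.bigmax_eq_arg s0) //.
  by case: arg_maxnP.
by move=> none; rewrite big_pred0.
Qed.

Lemma f_le (v : nat) : f v <= v.
Proof. by apply/bigmax_leqP=> s _; rewrite -ltnS. Qed.

Lemma f_suborder (v w : nat) :
  steiner_suborder v w -> w * (w + 5) = 6 * v -> f v = v - w.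
Proof.
move=> sub vw; apply/eqP; rewrite eqn_leq; apply/andP; split.
  apply/bigmax_leqP=> s /nonincident_bound; have := ltn_ord s; rewrite ltnS.
  move=> sv le_s; rewrite leqNgt; apply/negP=> lt_s.
  (* Here [v - s < w], so [(v - s)(v - s - 1) <= w(w - 1) = 6(v - w) < 6s], against the bound. *)
  by nia.
have lt_v : v - w < v.+1 by rewrite ltnS leq_subr.
apply: (@leq_bigmax_cond _ _ _ (Ordinal lt_v)) => /=.
apply: suborder_nonincident => //.
by nia.
Qed.

(** * Residues of [w] modulo 36 and the four families *)

Lemma suborder_residues (v w : nat) :
  v = 1 %[mod 6] \/ v = 3 %[mod 6] -> odd w -> w * (w + 5) = 6 * v ->
  exists z, [\/ w = 36 * z + 1, w = 36 * z + 13, w = 36 * z + 9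
    | w = 36 * z + 21].
Proof.
move=> hv ow; rewrite (divn_eq w 36) in ow *.
move: (w %/ 36) (w %% 36) (ltn_pmod w (isT : 0 < 36)) ow => q r r36 ow vw.
have {}vw : 36 * (36 * q * q + 2 * q * r + 5 * q) + r * (r + 5) = 6 * v.
  by rewrite -vw; ring.
exists q; move: (36 * q * q + _ + _) vw => K vw.
(* As [v] is 1 or 3 modulo 6, [r(r + 5)] is 6 or 18 modulo 36; only these odd residues qualify. *)
have : r \in [:: 1; 13; 9; 21].
  rewrite oddD oddM /= andbF in ow.
  by do 36?[case: r r36 ow vw => [|r] r36 ow vw; first by [|exfalso; case: hv; lia]].
rewrite !inE => /or4P[]/eqP->; rewrite mulnC;
  by [constructor 1|constructor 2|constructor 3|constructor 4].
Qed.

(* The subsystem is a first factor times a point in the first two families, and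
   a first factor times a block of the second in the last two. *)
Lemma steiner_suborder_family (z : nat) :
  [/\ steiner_suborder ((36 * z + 1) * (6 * z + 1)) (36 * z + 1),
      steiner_suborder ((36 * z + 13) * (6 * z + 3)) (36 * z + 13),
      steiner_suborder ((12 * z + 3) * (18 * z + 7)) (36 * z + 9)
    & steiner_suborder ((12 * z + 7) * (18 * z + 13)) (36 * z + 21)].
Proof.
have o1 k n : n = 6 * k + 1 -> steiner_order n.
  by move=> ->; exact: steiner_order_1mod6.
have o3 k n : n = 6 * k + 3 -> steiner_order n.
  by move=> ->; exact: steiner_order_3mod6.
split.
- rewrite -[X in steiner_suborder _ X]muln1; apply: steiner_suborder_prod.
    by apply: (o1 (6 * z)); lia.
  by apply: steiner_suborder1; [lia | exact: (o1 z)].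
- rewrite -[X in steiner_suborder _ X]muln1; apply: steiner_suborder_prod.
    by apply: (o1 (6 * z + 2)); lia.
  by apply: steiner_suborder1; [lia | exact: (o3 z)].
- have -> : 36 * z + 9 = (12 * z + 3) * 3 by lia.
  apply: steiner_suborder_prod; first by apply: (o3 (2 * z)); lia.
  by apply: steiner_suborder3; [lia | apply: (o1 (3 * z + 1)); lia].
- have -> : 36 * z + 21 = (12 * z + 7) * 3 by lia.
  apply: steiner_suborder_prod; first by apply: (o1 (2 * z + 1)); lia.
  by apply: steiner_suborder3; [lia | apply: (o1 (3 * z + 2)); lia].
Qed.

(** * The square root formula and the characterization *)

Local Open Scope ring_scope.

(** With [w = v - s] the formula says that the root is [2w + 5], and [(2w + 5)^2 = 24v + 25] amounts
    to [w(w + 5) = 6v]. *)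
Lemma sqrt_formulaP (R : rcfType) (v s : nat) : (s <= v)%N ->
  s%:R = (2 * v%:R + 5 - Num.sqrt (24 * v%:R + 25)) / 2 :> R <->
  ((v - s) * (v - s + 5) = 6 * v)%N.
Proof.
move=> /subnKC; move: (v - s)%N => w <-; rewrite natrD.
set t : R := s%:R; set u : R := w%:R.
have t0 : 0 <= t by exact: ler0n.
have u0 : 0 <= u by exact: ler0n.
split=> [E|/(congr1 (fun n : nat => n%:R : R))].
  have sq : Num.sqrt (24 * (t + u) + 25) = 2 * u + 5 by lra.
  have := @sqr_sqrtr _ (24 * (t + u) + 25) (ltac:(lra)); rewrite sq => Esq.
  by apply/eqP; rewrite -(eqr_nat R) !natrM !natrD -/t -/u; apply/eqP; lra.
rewrite !natrM !natrD -/t -/u => E.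
have -> : 24 * (t + u) + 25 = (2 * u + 5) ^+ 2 by lra.
by rewrite sqrtr_sqr ger0_norm; lra.
Qed.

Theorem theorem6 (R : rcfType) (v : nat) (hv0 : (0 < v)%N)
    (hv : v = 1 %[mod 6] \/ v = 3 %[mod 6]) :
  (f v)%:R = (2 * v%:R + 5 - Num.sqrt (24 * v%:R + 25)) / 2 :> R
  <->
  exists z : nat,
    v \in [:: 216 * z ^ 2 + 42 * z + 1;
              216 * z ^ 2 + 186 * z + 39;
              216 * z ^ 2 + 138 * z + 21;
              216 * z ^ 2 + 282 * z + 91]%N.
Proof.
apply: (iff_trans (sqrt_formulaP R v _ (f_le v))); split.
  (* If [f v = 0], then [v(v + 5) = 6v] leaves only [v = 1], the first family at [z = 0]. *)
  move=> vw; have fv := f_le v; have [f0|f_gt0] := posnP (f v).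
    by exists 0%N; rewrite (_ : v = 1%N) //; rewrite f0 subn0 in vw; nia.
  have fltv : (f v < v)%N by nia.
  (* For [w = v - f v] the equation reads [6 * f v = w(w - 1)], so a pair attaining [f v] is
     tight. *)
  have ow : odd (v - f v).
    by apply: nonincident_tight_odd (f_pair v f_gt0) _; [|nia].
  have [z wz] := suborder_residues _ _ hv ow vw; exists z; rewrite !inE.
  by case: wz vw => -> vw; apply/or4P;
    [constructor 1|constructor 2|constructor 3|constructor 4]; apply/eqP; lia.
move=> [z]; have [s1 s13 s9 s21] := steiner_suborder_family z.
have main w : steiner_suborder v w -> (w * (w + 5) = 6 * v)%N ->
    ((v - f v) * (v - f v + 5) = 6 * v)%N.
  move=> sub vw; rewrite (f_suborder _ _ sub vw) subKn //.
  by nia.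
rewrite !inE => /or4P[]/eqP vz.
(* In [v = w(w + 5)/6] the 6 divides [w + 5] in the first two families; in the last two, 3 divides
   [w] and 2 divides [w + 5]. *)
- apply: (main (36 * z + 1)%N); last by rewrite vz; lia.
  by rewrite (_ : v = (36 * z + 1) * (6 * z + 1))%N // vz; lia.
- apply: (main (36 * z + 13)%N); last by rewrite vz; lia.
  by rewrite (_ : v = (36 * z + 13) * (6 * z + 3))%N // vz; lia.
- apply: (main (36 * z + 9)%N); last by rewrite vz; lia.
  by rewrite (_ : v = (12 * z + 3) * (18 * z + 7))%N // vz; lia.
- apply: (main (36 * z + 21)%N); last by rewrite vz; lia.
  by rewrite (_ : v = (12 * z + 7) * (18 * z + 13))%N // vz; lia.
Qed.
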